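(* Up to Euclidean transformations, the only Eisenstein lattice equable parallelograms having a side of length $2\sqrt3$ or $4\sqrt3$ are, respectively, the parallelograms $Q_n$ ($n\ge1$) (for side length $2\sqrt3$) and the parallelograms $R_n$, $R'_n$ ($n\ge1$) (for side length $4\sqrt3$) defined in the context. Moreover, all Eisenstein lattice equable parallelograms with a vertical side have a side of length $2\sqrt3$ or $4\sqrt3$.
   Context: A planar polygon is equable if its perimeter equals its area. The Eisenstein lattice is $\mathbb{Z}[\omega]\subset\mathbb{C}$, where $\omega=-\frac12+i\frac{\sqrt3}{2}$. An Eisenstein lattice equable parallelogram (ELEP) is an equable parallelogram whose vertices all lie in $\mathbb{Z}[\omega]$. Vertical means parallel to the imaginary axis. Family with side $2\sqrt3$. Let $(u_n,m_n)_{n\ge1}$ be given by $(u_1,m_1)=(1,1)$, $(u_2,m_2)=(9,11)$ and $(u_n,m_n)=10(u_{n-1},m_{n-1})-(u_{n-2},m_{n-2})$ for $n\ge3$; these are the positive integer solutions $(u,m)$ of $3u^2=2m^2+1$. Put $x_n=3+3u_n$ and $y_n=2m_n$. $Q_n$ is the parallelogram with consecutive vertices $0,\ 2\sqrt3\,i,\ -x_n+(2+y_n)\sqrt3\,i,\ -x_n+y_n\sqrt3\,i$. It is an ELEP with a vertical side of length $2\sqrt3$. Families with side $4\sqrt3$. Consider sequences $(w_n,y_n)_{n\ge1}$ satisfying $$w_n=23w_{n-1}+2y_{n-1}+3,\qquad y_n=264w_{n-1}+23y_{n-1}+36\qquad(n\ge2),$$ with initial condition either $(w_1,y_1)=(1,13)$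 or $(w_1,y_1)=(5,59)$; together these two sequences give the positive integer solutions $(w,y)$ of $132w^2+36w+1=y^2$. Put $x_n=6w_n+3$ and consider the parallelogram with consecutive vertices $0,\ 4\sqrt3\,i,\ -x_n+(4+y_n)\sqrt3\,i,\ -x_n+y_n\sqrt3\,i$. It is an ELEP with a vertical side of length $4\sqrt3$. It is denoted $R_n$ for the sequence with $(w_1,y_1)=(1,13)$ and $R'_n$ for the sequence with $(w_1,y_1)=(5,59)$.
   Formalization: For side length 4√3 the formal statement also allows Q_1, which has sides 2√3 and 4√3 and is congruent to no R_n or R'_n, so the literal ''respectively'' claim fails for it; every other ELEP with a side 4√3 is some R_n or R'_n. *)

(* Defs.v *)
From Stdlib Require Import Reals ZArith List.
From Coquelicot Require Import Coquelicot.
Import ListNotations.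
Open Scope R_scope.

(** A polygon is the list of its vertices in cyclic order; its sides are the
    consecutive pairs, including the closing pair (last vertex, first vertex). *)
Definition polygon : Type := list C.

Definition sides (P : polygon) : list (C * C) :=
  combine P (tl P ++ firstn 1 P).

Definition side_length (s : C * C) : R := Cmod (Cminus (snd s) (fst s)).

Definition Rsum (l : list R) : R := fold_right Rplus 0 l.

Definition perimeter (P : polygon) : R := Rsum (map side_length (sides P)).

(** Area enclosed by a simple polygon, by the shoelace formula. *)
Definition area (P : polygon) : R :=
  Rabs (Rsum (map (fun s : C * C =>
                     Re (fst s) * Im (snd s) - Re (snd s) * Im (fst s))
                  (sides P))) / 2.

Definition equable (P : polygon) : Prop := perimeter P = area P.

(** The last condition says that [a], [b], [d] are not collinear, which
    excludes degenerate parallelograms. *)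
Definition parallelogram (P : polygon) : Prop :=
  exists a b c d : C,
    P = [a; b; c; d] /\
    Cminus b a = Cminus c d /\
    Im (Cmult (Cconj (Cminus b a)) (Cminus d a)) <> 0.

Definition omega : C := (- (1 / 2), sqrt 3 / 2).

Definition eisenstein (z : C) : Prop :=
  exists a b : Z,
    z = Cplus (RtoC (IZR a)) (Cmult (RtoC (IZR b)) omega).

Definition ELEP (P : polygon) : Prop :=
  parallelogram P /\ equable P /\ (forall z : C, In z P -> eisenstein z).

Definition has_side_of_length (P : polygon) (l : R) : Prop :=
  exists s, In s (sides P) /\ side_length s = l.

Definition has_vertical_side (P : polygon) : Prop :=
  exists s, In s (sides P) /\ fst s <> snd s /\ Re (fst s) = Re (snd s).

(** Two vertex lists describe the same polygon when they have the same
    unoriented sides; the starting vertex and the orientation are irrelevant. *)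
Definition is_side (P : polygon) (a b : C) : Prop :=
  In (a, b) (sides P) \/ In (b, a) (sides P).

Definition same_polygon (P Q : polygon) : Prop :=
  forall a b : C, is_side P a b <-> is_side Q a b.

Definition isometry (f : C -> C) : Prop :=
  forall z w : C, Cmod (Cminus (f z) (f w)) = Cmod (Cminus z w).

Definition congruent (P Q : polygon) : Prop :=
  exists f : C -> C, isometry f /\ same_polygon (map f P) Q.

(** Vertices [0], [k sqrt 3 i], [-x + (k + y) sqrt 3 i], [-x + y sqrt 3 i]. *)
Definition vertical_parallelogram (k x y : Z) : polygon :=
  [ (0, 0);
    (0, IZR k * sqrt 3);
    (- IZR x, IZR (k + y) * sqrt 3);
    (- IZR x, IZR y * sqrt 3) ].

(** All sequences below are indexed from 1; the value at 0 is a dummy that the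
    other values do not depend on. *)
Fixpoint um (n : nat) : Z * Z :=
  match n with
  | 0%nat => (0, 0)%Z
  | 1%nat => (1, 1)%Z
  | 2%nat => (9, 11)%Z
  | S (S k as p) =>
      (10 * fst (um p) - fst (um k), 10 * snd (um p) - snd (um k))%Z
  end.

Definition Q_ (n : nat) : polygon :=
  vertical_parallelogram 2 (3 + 3 * fst (um n)) (2 * snd (um n)).

Fixpoint wy (init : Z * Z) (n : nat) : Z * Z :=
  match n with
  | 0%nat => (0, 0)%Z
  | 1%nat => init
  | S p =>
      (23 * fst (wy init p) + 2 * snd (wy init p) + 3,
       264 * fst (wy init p) + 23 * snd (wy init p) + 36)%Z
  end.

Definition R_family (init : Z * Z) (n : nat) : polygon :=
  vertical_parallelogram 4 (6 * fst (wy init n) + 3) (snd (wy init n)).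

Definition R_ (n : nat) : polygon := R_family (1, 13)%Z n.

Definition R'_ (n : nat) : polygon := R_family (5, 59)%Z n.

(* Main.v *)
(** A unit of Z[ω], a translation and reflections bring an ELEP having a side
    [k √3 i] (a positive integer [k]) to the parallelogram spanned by
    [k √3 i] and [(-3z + y √3 i)/2] with [z ≡ y] mod 2, and being equable becomes
    [12 z² + 4 y² = k² (3z - 4)²].

    For [k = 2] and [k = 4] this is a Pell equation, solved by descent with the
    units [5 + 2√6] and [23 + 4√33].  For arbitrary [k] (a vertical side), factor
    [(k(3z - 4) - 2y) (k(3z - 4) + 2y) = 3 (2z)²]: one factor is [g b²] and the
    other [3 g a²], with [2z = g a b], so that [g N = 8k] where
    [N = 3kab - 3a² - b²].  Vieta jumping in [(a, b)] bounds [N] from below, and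
    together with the parities this forces [k = 2] or [k = 4]. *)

Require Import Defs.
From Stdlib Require Import Reals ZArith List Lra Lia Znumtheory Zwf.
From Coquelicot Require Import Coquelicot.
Import ListNotations.
Open Scope R_scope.

(** * Integer equations *)

Open Scope Z_scope.

(** * Pell equations for the sides [2√3] and [4√3] *)

(** This is multiplication of [u√3 + m√2] by [5 + 2√6]. Its matrix has trace 10 and determinant 1,
    so Cayley-Hamilton yields the three-term recurrence of [um]. *)
Lemma um_step (n : nat) (hn : (1 <= n)%nat) :
  um (S n) = (5 * fst (um n) + 4 * snd (um n), 6 * fst (um n) + 5 * snd (um n)).
Proof.
  induction n as [|[|n] IH]; [lia | reflexivity |].
  change (um (S (S (S n)))) with
    (10 * fst (um (S (S n))) - fst (um (S n)), 10 * snd (um (S (S n))) - snd (um (S n))).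
  rewrite IH by lia; destruct (um (S n)); cbn [fst snd]; apply f_equal2; lia.
Qed.

Lemma um_pell (n : nat) (hn : (1 <= n)%nat) :
  3 * (fst (um n) * fst (um n)) = 2 * (snd (um n) * snd (um n)) + 1 /\
  0 < fst (um n) /\ 0 < snd (um n).
Proof.
  induction n as [|[|n] IH]; [lia | simpl; lia |].
  rewrite um_step by lia.
  destruct IH as (E & Hu & Hm); [lia|]; cbn [fst snd]; split; [|split]; nia.
Qed.

(** Descent by the inverse unit [5 - 2√6], which lowers [m] until only [(1, 1)] is left. *)
Lemma um_complete (u m : Z) (hu : 0 < u) (hm : 0 < m)
  (E : 3 * (u * u) = 2 * (m * m) + 1) :
  exists n, (1 <= n)%nat /\ um n = (u, m).
Proof.
  revert u hu hm E; induction m as [m IH] using (well_founded_induction (Zwf_well_founded 0)).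
  intros u hu hm E.
  (* By the equation, [5 * m - 6 * u] is positive exactly when [m * m > 12], so the descent can
     start at [m = 4]. *)
  destruct (Z_le_gt_dec m 3) as [Hm|Hm].
  { assert (u <= 3) by nia. assert (Hc : m = 1 \/ m = 2 \/ m = 3) by lia.
    assert (Hd : u = 1 \/ u = 2 \/ u = 3) by lia.
    destruct Hc as [->|[->| ->]], Hd as [->|[->| ->]]; try lia.
    exists 1%nat; split; [lia|reflexivity]. }
  destruct (IH (5 * m - 6 * u)) with (u := 5 * u - 4 * m) as (n & Hn & En).
  - unfold Zwf; nia.
  - nia.
  - nia.
  - nia.
  - exists (S n); split; [lia|]; rewrite um_step, En by lia; cbn [fst snd]; apply f_equal2; lia.
Qed.

Lemma wy_step (i : Z * Z) (n : nat) (hn : (1 <= n)%nat) :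
  wy i (S n) = (23 * fst (wy i n) + 2 * snd (wy i n) + 3,
                264 * fst (wy i n) + 23 * snd (wy i n) + 36).
Proof. destruct n; [lia | reflexivity]. Qed.

Lemma wy_pell (i : Z * Z) (n : nat) (hn : (1 <= n)%nat)
  (hi : 132 * (fst i * fst i) + 36 * fst i + 1 = snd i * snd i /\
        0 < fst i /\ 0 < snd i) :
  132 * (fst (wy i n) * fst (wy i n)) + 36 * fst (wy i n) + 1 =
    snd (wy i n) * snd (wy i n) /\ 0 < fst (wy i n) /\ 0 < snd (wy i n).
Proof.
  induction n as [|[|n] IH]; [lia | exact hi |].
  rewrite wy_step by lia.
  destruct IH as (E & Hu & Hm); [lia|]; cbn [fst snd]; split; [|split]; nia.
Qed.

(* With [t = 11 z - 16] the equation is [3 t² - 11 y² = 64]; multiplication by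
   [23 - 4√33] preserves [t > 0] and the class [t ≡ 6] mod 11, so that [z] stays an
   integer. The descent ends at [(z, y) = (2, ±2)]; [(2, 2)] is [Q_ 1]. *)
Lemma wy_complete (z y : Z) (hz : 2 <= z) (hy : 0 <= y)
  (E : y * y = 33 * (z * z) - 96 * z + 64) :
  (z = 2 /\ y = 2) \/
  exists n i, (1 <= n)%nat /\ (i = (1, 13) \/ i = (5, 59)) /\
    z = 4 * fst (wy i n) + 2 /\ y = 2 * snd (wy i n).
Proof.
  revert z hz hy E; induction y as [y IH] using (well_founded_induction (Zwf_well_founded 0)).
  intros z hz hy E.
  (* The descended ordinate [23 y - 12 t] is nonnegative exactly when [y * y >= 3072], that is from
     [y = 56] on. *)
  destruct (Z_le_gt_dec y 55) as [Hy|Hy].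
  { assert (z <= 12) by nia.
    assert (y = Z.sqrt (33 * (z * z) - 96 * z + 64)) as Hs
      by (rewrite <- E; symmetry; apply Z.sqrt_square; lia).
    assert (Hc : z = 2 \/ z = 3 \/ z = 4 \/ z = 5 \/ z = 6 \/ z = 7 \/ z = 8 \/ z = 9 \/
      z = 10 \/ z = 11 \/ z = 12) by lia.
    repeat (destruct Hc as [->|Hc]; [vm_compute in Hs; subst y; vm_compute in E; try discriminate E|]).
    - left; lia.
    - right; exists 1%nat, (1, 13); repeat split; auto.
    - subst z; vm_compute in Hs; subst y; vm_compute in E; discriminate E. }
  destruct (IH (23 * y - 132 * z + 192)) with (z := 23 * z - 32 - 4 * y)
    as [[Ez Ey]|(n & i & Hn & Hi & Ez & Ey)].
  - unfold Zwf; nia.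
  (* The left side is the new [t], equal to [11 z' - 16] for the new [z']; its positivity forces
     [z' >= 2]. *)
  - assert (0 < 23 * (11 * z - 16) - 44 * y) by nia. lia.
  - nia.
  - nia.
  (* One step above [(2, 2)] lies [(z, y) = (22, 118)], the start of the second family. *)
  - right; exists 1%nat, (5, 59); cbn [wy fst snd]; repeat split; auto; lia.
  - right; exists (S n), i; rewrite wy_step by lia; cbn [fst snd]; repeat split; auto; lia.
Qed.

(** * The equation for a vertical side of arbitrary length *)

(** At a fixed value of the form, the two roots in [b] sum to [3ka] and the two roots in [a] sum to
    [kb]. Passing to the other root keeps the value and, for even [k], the parities; descent on
    [a + b] ends in a region where the value is at least [kab / 2]. The bound [3k - 4] is the value
    at [(1, 1)]. *)
Lemma vieta_lower_bound (k a b : Z) (hk : 3 <= k) (ha : 0 < a) (hb : 0 < b)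
  (hN : 0 < 3 * k * a * b - 3 * (a * a) - b * b) :
  3 * k - 4 <= 3 * k * a * b - 3 * (a * a) - b * b /\
  (Z.Even k -> Z.Odd a -> Z.Odd b ->
   3 * k * a * b - 3 * (a * a) - b * b = 3 * k - 4 \/
   4 * k < 3 * k * a * b - 3 * (a * a) - b * b).
Proof.
  remember (a + b) as n eqn:En.
  revert a b ha hb hN En; induction n as [n IH] using (well_founded_induction (Zwf_well_founded 0)).
  intros a b ha hb hN En.
  destruct (Z_lt_le_dec (3 * k * a) (2 * b)) as [H1|H1].
  (* The other root stays positive because [b (3ka - b) = N + 3a²], where [N > 0] is the value of
     the form. *)
  { destruct (IH (a + (3 * k * a - b))) with (a := a) (b := 3 * k * a - b) as [I1 I2];
      [unfold Zwf; nia | lia | nia | nia | reflexivity |].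
    replace (3 * k * a * (3 * k * a - b) - 3 * (a * a) - (3 * k * a - b) * (3 * k * a - b))
      with (3 * k * a * b - 3 * (a * a) - b * b) in * by ring.
    split; [exact I1|]; intros Hk Ha Hb; apply I2; auto.
    destruct Hk as [k' ->], Hb as [b' ->]; exists (3 * k' * a - b' - 1); lia. }
  destruct (Z_lt_le_dec (k * b) (2 * a)) as [H2|H2].
  { destruct (IH ((k * b - a) + b)) with (a := k * b - a) (b := b) as [I1 I2];
      [unfold Zwf; nia | nia | lia | nia | reflexivity |].
    replace (3 * k * (k * b - a) * b - 3 * ((k * b - a) * (k * b - a)) - b * b)
      with (3 * k * a * b - 3 * (a * a) - b * b) in * by ring.
    split; [exact I1|]; intros Hk Ha Hb; apply I2; auto.
    destruct Hk as [k' ->], Ha as [a' ->]; exists (k' * b - a' - 1); lia. }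
  clear IH.
  (* No jump decreases [(a, b)] any more: [2b <= 3ka] and [2a <= kb]. *)
  assert (Hgen : k * (a * b) <= 2 * (3 * k * a * b - 3 * (a * a) - b * b)).
  { destruct (Z_le_gt_dec b (k * a)).
    - assert (2 * (a * a) <= k * (a * b)) by nia. assert (b * b <= k * (a * b)) by nia. nia.
    - assert (3 * (a * a) <= a * b) by nia. assert (2 * (b * b) <= 3 * k * (a * b)) by nia. nia. }
  (* [Hgen] gives [N >= 3k] once [ab >= 6], and [N >= 9k/2 > 4k] once [ab >= 9], which holds for odd
     [a, b >= 3]. Pairs with an entry 1 and the pair [(2, 2)] are treated directly. *)
  destruct (Z.eq_dec b 1) as [->|Hb1].
  { destruct (Z.eq_dec a 1) as [->|Ha1]; [lia|].
    split; [nia|]. intros _ Ha _. assert (3 <= a) by (destruct Ha; lia). right. nia. }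
  destruct (Z.eq_dec a 1) as [->|Ha1].
  { split; [nia|]. intros _ _ Hb. assert (3 <= b) by (destruct Hb; lia). right. nia. }
  split.
  { assert (2 <= a) by lia. assert (2 <= b) by lia.
    assert (Hc : (a = 2 /\ b = 2) \/ 6 <= a * b) by nia.
    destruct Hc as [[-> ->]|Hc]; [lia|nia]. }
  intros _ [a' Ha] [b' Hb]. right.
  assert (3 <= a) by lia. assert (3 <= b) by lia. assert (9 <= a * b) by nia. nia.
Qed.

(** With [h = gcd x n], [x = p h] and [n = q h], cancelling [h] leaves [p y = 3 h q²], so [p]
    divides [3 h]. Whether 3 divides [p] decides which factor carries the 3. *)
Lemma factor_three_squares (x y n : Z) (hx : 0 < x) (hn : 0 < n)
  (E : x * y = 3 * (n * n)) :
  exists g a b, 0 < g /\ 0 < a /\ 0 < b /\ rel_prime a b /\ n = g * a * b /\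
    ((x = g * (b * b) /\ y = 3 * g * (a * a)) \/
     (x = 3 * g * (a * a) /\ y = g * (b * b))).
Proof.
  assert (Hh : 0 < Z.gcd x n).
  { pose proof (Z.gcd_nonneg x n). destruct (Z.eq_dec (Z.gcd x n) 0) as [H0|H0]; [|lia].
    apply Z.gcd_eq_0 in H0; lia. }
  assert (Hxn : Zis_gcd x n (Z.gcd x n)) by apply Zgcd_is_gcd.
  set (h := Z.gcd x n) in *.
  assert (Hr := Zis_gcd_rel_prime x n h ltac:(lia) ltac:(lia) Hxn).
  destruct Hxn as [[p Hp] [q Hq] _].
  rewrite Hp, Hq, !Z.div_mul in Hr by lia.
  assert (0 < p) by nia. assert (0 < q) by nia.
  assert (E' : p * y = 3 * h * (q * q)) by nia.
  assert (Hd : (p | 3 * h)).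
  { apply Gauss with (q * q).
    - exists y; lia.
    - apply rel_prime_mult; assumption. }
  destruct (Zdivide_dec 3 p) as [[p' Hp']|H3].
  - destruct Hd as [g Hg]. assert (Eh : h = g * p') by lia.
    exists g, p', q. split; [nia|split; [nia|split; [nia|split; [|split; [nia|]]]]].
    + destruct Hr as [_ _ Hr].
      constructor; try apply Z.divide_1_l. intros d [e He] Hdq. apply Hr; [exists (3 * e); lia | exact Hdq].
    + right; split; nia.
  - assert (Hd' : (p | h)).
    { apply Gauss with 3; [exact Hd|]. apply rel_prime_sym, prime_rel_prime; [apply prime_3|exact H3]. }
    destruct Hd' as [g Hg].
    exists g, q, p. split; [nia|split; [nia|split; [nia|split; [|split; [nia|]]]]].
    + apply rel_prime_sym; exact Hr.
    + left; split; nia.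
Qed.

Lemma even_of_mul_odd (m n : Z) (ho : Z.Odd n) (he : Z.Even (m * n)) : Z.Even m.
Proof.
  destruct (Z.Even_or_Odd m) as [H|[m' ->]]; [exact H|].
  destruct ho as [n' ->], he as [e He]; exfalso.
  assert (2 * (e - 2 * (m' * n') - m' - n') = 1) by nia. lia.
Qed.

Lemma vertical_side_2_or_4 (k z y : Z) (hk : 1 <= k) (hz : 2 <= z)
  (hzy : Z.Even (z - y))
  (E : 12 * (z * z) + 4 * (y * y) = k * k * ((3 * z - 4) * (3 * z - 4))) :
  k = 2 \/ k = 4.
Proof.
  set (s := 3 * z - 4) in *.
  assert (Hs : 0 < s) by (unfold s; lia).
  assert (EF : (k * s - 2 * y) * (k * s + 2 * y) = 3 * ((2 * z) * (2 * z))) by nia.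
  assert (Hks : 0 < k * s) by nia.
  assert (Hpos : 0 < k * s - 2 * y).
  { destruct (Z_lt_le_dec 0 (k * s - 2 * y)) as [H|H]; [exact H|].
    assert ((k * s - 2 * y) * (k * s + 2 * y) <= 0) by (apply Z.mul_nonpos_nonneg; lia).
    assert (0 < z * z) by nia. lia. }
  destruct (factor_three_squares _ _ (2 * z) Hpos ltac:(lia) EF)
    as (g & a & b & Hg & Ha & Hb & Hab & Hz & HF).
  (* The sum of the two factors is [2 k s], their difference gives [4 y], and [2 s = 3 (2 z) - 8] is
     expressed by [g a b]. *)
  assert (HN : g * (3 * k * a * b - 3 * (a * a) - b * b) = 8 * k).
  { assert (2 * (k * s) = g * (3 * (a * a) + b * b)) by (destruct HF as [[? ?]|[? ?]]; lia).
    assert (H2 : 2 * s = 3 * (g * a * b) - 8) by (unfold s; lia).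
    assert (k * (2 * s) = k * (3 * (g * a * b) - 8)) by (rewrite H2; reflexivity). lia. }
  assert (Hy : 4 * y = g * (3 * (a * a) - b * b) \/ 4 * y = - (g * (3 * (a * a) - b * b))).
  { destruct HF as [[? ?]|[? ?]]; [left|right]; lia. }
  set (N := 3 * k * a * b - 3 * (a * a) - b * b) in *.
  assert (HN0 : 0 < N) by (apply (Z.mul_pos_cancel_l g N); lia).
  (* For [k = 1] the form is negative definite: [4 N = - (2b - 3a)² - 3a²]. *)
  destruct (Z.eq_dec k 1) as [->|Hk1]; [exfalso; pose proof (Z.square_nonneg (2 * b - 3 * a)); pose proof (Z.square_nonneg a);
    clear - H H0 HN0; unfold N in HN0; lia|].
  destruct (Z.eq_dec k 2) as [->|Hk2]; [left; reflexivity|].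
  destruct (vieta_lower_bound k a b ltac:(lia) Ha Hb HN0) as [V1 V2]; fold N in V1, V2.
  (* Otherwise [N] divides [k], whereas [N >= 3k - 4 > k]. *)
  assert (Hno : forall e, g = 8 * e -> False) by (intros e ->; clear - hk Hk1 Hk2 HN V1 Hg; nia).
  (* For [a], [b] of opposite parity, [4 y = ± g M] with [M] odd makes 4 divide [g]. Then [z] is
     even, hence so is [y], and this yields a third factor 2 in [g]. *)
  assert (Hmix : Z.Odd (3 * (a * a) - b * b) -> Z.Even (a * b) -> False).
  { clear - hzy Hz Hy Hno. intros Ho [e He].
    rewrite <- Z.mul_assoc, He in Hz. set (M := 3 * (a * a) - b * b) in *.
    destruct (even_of_mul_odd g _ Ho) as [g1 ->]; [destruct Hy; [exists (2 * y)|exists (- 2 * y)]; lia|].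
    destruct (even_of_mul_odd g1 _ Ho) as [g2 ->]; [destruct Hy; [exists y|exists (- y)]; lia|].
    destruct hzy as [f Hf].
    destruct (even_of_mul_odd g2 _ Ho) as [g3 ->];
      [destruct Hy; [exists (2 * (g2 * e) - f)|exists (f - 2 * (g2 * e))]; lia|].
    apply (Hno g3); lia. }
  destruct (Z.Even_or_Odd a) as [[a' Ea]|[a' Ea]];
  destruct (Z.Even_or_Odd b) as [[b' Eb]|[b' Eb]].
  - exfalso. destruct Hab as [_ _ Hab].
    assert (H2 : (2 | 1)) by (apply Hab; [exists a' | exists b']; lia).
    destruct H2; lia.
  - exfalso; apply Hmix; [exists (6 * (a' * a') - 2 * (b' * b') - 2 * b' - 1)|exists (a' * b)]; subst a b; ring.
  - exfalso; apply Hmix; [exists (6 * (a' * a') + 6 * a' + 1 - 2 * (b' * b'))|exists (a * b')]; subst a b; ring.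
  - assert (Hgab : Z.Even g).
    { apply even_of_mul_odd with (a * b).
      - exists (2 * a' * b' + a' + b'); subst a b; ring.
      - exists z; lia. }
    destruct Hgab as [g' ->].
    (* Now [g' N = 4 k]. For even [k] this excludes [N > 4 k], and [g' (3k - 4) = 4 k] leaves
       [g' = 2], [k = 4]. For odd [k], [N] is odd, so 4 divides [g'] and 8 divides [g]. *)
    destruct (Z.Even_or_Odd k) as [Hk|[k' Ek]].
    + destruct V2 as [V2|V2]; [exact Hk | exists a'; exact Ea | exists b'; exact Eb | |exfalso; clear - HN V2 Hg hk; nia].
      right. assert (Hg' : g' = 1 \/ g' = 2 \/ 3 <= g') by lia.
      rewrite V2 in HN; clear - HN Hg' hk Hk1 Hk2.
      destruct Hg' as [->|[->|Hg']]; [lia|lia|nia].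
    + exfalso.
      assert (HNo : Z.Odd N).
      { exists (3 * (4 * k' * a' * b' + 2 * k' * a' + 2 * k' * b' + 2 * a' * b' + k' + a' + b')
                - 6 * (a' * a') - 6 * a' - 2 * (b' * b') - 2 * b' - 1).
        unfold N; subst k a b; ring. }
      destruct (even_of_mul_odd g' N HNo) as [g1 Hg1]; [exists (2 * k); lia|].
      destruct (even_of_mul_odd g1 N HNo) as [g2 Hg2]; [exists k; subst g'; lia|].
      apply (Hno g2); lia.
Qed.

Close Scope Z_scope.

(** * Parallelograms in the Eisenstein lattice *)

Lemma sqrt3_sq : sqrt 3 * sqrt 3 = 3.
Proof. apply sqrt_sqrt; lra. Qed.

Lemma sqrt3_pos : 0 < sqrt 3.
Proof. apply sqrt_lt_R0; lra. Qed.

Lemma eisenstein_coords (z : C) :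
  eisenstein z <->
  exists a b : Z, z = (IZR a - IZR b / 2, IZR b * sqrt 3 / 2).
Proof.
  unfold eisenstein, omega; split; intros (a & b & ->); exists a, b;
    unfold Cplus, Cmult, RtoC; simpl; f_equal; field.
Qed.

Lemma eisenstein_minus (z w : C) (hz : eisenstein z) (hw : eisenstein w) :
  eisenstein (Cminus z w).
Proof.
  apply eisenstein_coords in hz as (a & b & ->).
  apply eisenstein_coords in hw as (c & d & ->).
  apply eisenstein_coords; exists (a - c)%Z, (b - d)%Z.
  rewrite !minus_IZR; unfold Cminus, Cplus, Copp; simpl; f_equal; field.
Qed.

Lemma eisenstein_mult (z w : C) (hz : eisenstein z) (hw : eisenstein w) :
  eisenstein (Cmult z w).
Proof.
  apply eisenstein_coords in hz as (a & b & ->).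
  apply eisenstein_coords in hw as (c & d & ->).
  apply eisenstein_coords; exists (a * c - b * d)%Z, (a * d + b * c - b * d)%Z.
  rewrite !minus_IZR, !plus_IZR, !mult_IZR; unfold Cmult; simpl.
  pose proof sqrt3_sq as H3. f_equal; [|field].
  replace (IZR b * sqrt 3 / 2 * (IZR d * sqrt 3 / 2))
    with (IZR b * IZR d * (sqrt 3 * sqrt 3) / 4) by field.
  rewrite H3; field.
Qed.

(** * Polygons up to relabelling and congruence *)

Lemma same_polygon_reverse (a b c d : C) : same_polygon [a; b; c; d] [a; d; c; b].
Proof. intros x y; unfold is_side, sides; simpl; intuition congruence. Qed.

Lemma same_polygon_rotate (a b c d : C) : same_polygon [a; b; c; d] [b; c; d; a].
Proof. intros x y; unfold is_side, sides; simpl; tauto. Qed.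

Lemma same_polygon_trans (P Q S : polygon)
  (hPQ : same_polygon P Q) (hQS : same_polygon Q S) : same_polygon P S.
Proof. intros x y; rewrite (hPQ x y); apply hQS. Qed.

Lemma same_polygon_sym (P Q : polygon) (h : same_polygon P Q) : same_polygon Q P.
Proof. intros x y; symmetry; apply h. Qed.

Lemma sides_map (f : C -> C) (P : polygon) :
  sides (map f P) = map (fun s => (f (fst s), f (snd s))) (sides P).
Proof.
  unfold sides.
  replace (tl (map f P) ++ firstn 1 (map f P)) with (map f (tl P ++ firstn 1 P))
    by (destruct P; simpl; [|rewrite map_app]; reflexivity).
  (* The rotated list has to vary independently of [P] for the induction through [combine]. *)
  generalize (tl P ++ firstn 1 P); intro l; revert l.
  induction P as [|x P IH]; intros [|y l]; simpl; [reflexivity..|].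
  f_equal; apply IH.
Qed.

Lemma is_side_map (f : C -> C) (P : polygon) (x y : C) :
  is_side (map f P) x y <-> exists a b, is_side P a b /\ x = f a /\ y = f b.
Proof.
  unfold is_side; rewrite sides_map, !in_map_iff; split.
  - intros [([a b] & E & H)|([a b] & E & H)]; injection E as <- <-; eauto 6.
  - intros (a & b & [H|H] & -> & ->); [left; exists (a, b) | right; exists (b, a)]; auto.
Qed.

Lemma same_polygon_map (f : C -> C) (P Q : polygon) (h : same_polygon P Q) :
  same_polygon (map f P) (map f Q).
Proof.
  intros x y; rewrite !is_side_map.
  split; intros (a & b & H & E); exists a, b; split; try exact E; apply h; exact H.
Qed.

Lemma congruent_trans (P Q S : polygon)
  (hPQ : congruent P Q) (hQS : congruent Q S) : congruent P S.
Proof.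
  destruct hPQ as (f & Hf & HPQ), hQS as (g & Hg & HQS).
  exists (fun z => g (f z)); split.
  - intros z w; rewrite Hg; apply Hf.
  - rewrite <- map_map. apply same_polygon_trans with (map g Q); [|exact HQS].
    apply same_polygon_map; exact HPQ.
Qed.

Lemma same_polygon_congruent (P Q : polygon) (h : same_polygon P Q) : congruent P Q.
Proof.
  exists (fun z => z); split; [intros z w; reflexivity|]. rewrite map_id; exact h.
Qed.

Lemma parallelogram_vertex (a b c d : C) (h : Cminus b a = Cminus c d) :
  c = Cminus (Cplus b d) a.
Proof.
  destruct a, b, c, d; unfold Cminus, Cplus, Copp in *; simpl in *.
  injection h as h1 h2; f_equal; lra.
Qed.

(** * Perimeter, area and choice of the first side *)

Definition cross (p q : C) : R := Re p * Im q - Im p * Re q.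

Lemma cross_conj (p q : C) : Im (Cmult (Cconj p) q) = cross p q.
Proof. destruct p, q; unfold cross; simpl; ring. Qed.

Lemma perimeter_parallelogram (a b c d : C) (h : Cminus b a = Cminus c d) :
  perimeter [a; b; c; d] = 2 * (Cmod (Cminus b a) + Cmod (Cminus d a)).
Proof.
  rewrite (parallelogram_vertex a b c d h); clear h c.
  unfold perimeter, sides, Rsum, side_length; cbn [tl firstn app combine map fold_right fst snd].
  replace (Cminus (Cminus (Cplus b d) a) b) with (Cminus d a) by (apply injective_projections; simpl; ring).
  replace (Cminus d (Cminus (Cplus b d) a)) with (Copp (Cminus b a)) by (apply injective_projections; simpl; ring).
  replace (Cminus a d) with (Copp (Cminus d a)) by (apply injective_projections; simpl; ring).
  rewrite !Cmod_opp; ring.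
Qed.

Lemma area_parallelogram (a b c d : C) (h : Cminus b a = Cminus c d) :
  area [a; b; c; d] = Rabs (cross (Cminus b a) (Cminus d a)).
Proof.
  rewrite (parallelogram_vertex a b c d h); clear h c.
  unfold area, sides, Rsum, cross, Re, Im; simpl.
  match goal with |- Rabs ?x / 2 = Rabs ?y => replace x with (2 * y) by ring end.
  rewrite Rabs_mult, (Rabs_pos_eq 2) by lra; field.
Qed.

Lemma ELEP_rotate (a b c d : C) (h : ELEP [a; b; c; d]) : ELEP [b; c; d; a].
Proof.
  destruct h as ((a' & b' & c' & d' & E & H & Hn) & He & Hl).
  injection E as <- <- <- <-.
  assert (H' : Cminus c b = Cminus d a)
    by (rewrite (parallelogram_vertex a b c d H); apply injective_projections; simpl; ring).
  assert (Hx : cross (Cminus c b) (Cminus a b) = cross (Cminus b a) (Cminus d a)).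
  { rewrite (parallelogram_vertex a b c d H); unfold cross, Re, Im; simpl; ring. }
  split; [|split].
  - exists b, c, d, a; split; [reflexivity|]; split; [exact H'|].
    rewrite cross_conj, Hx, <- cross_conj; exact Hn.
  - unfold equable in *.
    rewrite perimeter_parallelogram, area_parallelogram in * by assumption.
    rewrite Hx, <- He, H'. replace (Cminus a b) with (Copp (Cminus b a))
      by (apply injective_projections; simpl; ring).
    rewrite Cmod_opp; ring.
  - intros z Hz; apply Hl; simpl in *; tauto.
Qed.

(** Cyclic relabelling preserves all defining conditions, so a distinguished side may be taken as
    the first one. *)
Lemma ELEP_start_at_side (P : polygon) (s : C * C) (h : ELEP P) (hs : In s (sides P)) :
  exists a b c d, same_polygon P [a; b; c; d] /\ ELEP [a; b; c; d] /\ s = (a, b).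
Proof.
  pose proof h as ((a & b & c & d & -> & _) & _).
  pose proof (ELEP_rotate _ _ _ _ h) as h1.
  pose proof (ELEP_rotate _ _ _ _ h1) as h2.
  pose proof (ELEP_rotate _ _ _ _ h2) as h3.
  destruct hs as [<-|[<-|[<-|[<-|[]]]]].
  - exists a, b, c, d; split; [intros x y; reflexivity | auto].
  - exists b, c, d, a; split; [apply same_polygon_rotate | auto].
  - exists c, d, a, b; split; [intros x y; unfold is_side, sides; simpl; tauto | auto].
  - exists d, a, b, c; split; [apply same_polygon_sym, same_polygon_rotate | auto].
Qed.

(** * Reduction to a normal form with a vertical side *)

(** Isolating the modulus gives [4 m = k √3 (|x| - 4)], whence [|x| >= 4]. Squaring gives
    [4 (x² + 3 y²) = 3 k² (|x| - 4)²], which forces 3 to divide [x]. *)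
Lemma equable_equation (k x y : Z) (hk : (1 <= k)%Z)
  (E : 2 * (IZR k * sqrt 3 + Cmod (IZR x / 2, IZR y * sqrt 3 / 2)) =
       Rabs (IZR k * sqrt 3 * (IZR x / 2))) :
  exists z, Z.abs x = (3 * z)%Z /\ (2 <= z)%Z /\
    (12 * (z * z) + 4 * (y * y) = k * k * ((3 * z - 4) * (3 * z - 4)))%Z.
Proof.
  pose proof sqrt3_sq as H3. pose proof sqrt3_pos as H3p.
  assert (Hk : 1 <= IZR k) by (apply IZR_le; exact hk).
  set (m := Cmod (IZR x / 2, IZR y * sqrt 3 / 2)) in *.
  assert (Hm : m * m = (IZR x * IZR x + 3 * (IZR y * IZR y)) / 4).
  { unfold m, Cmod; rewrite sqrt_sqrt by (simpl; nra). simpl.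
    replace (IZR y * sqrt 3 / 2 * (IZR y * sqrt 3 / 2 * 1))
      with (IZR y * IZR y * (sqrt 3 * sqrt 3) / 4) by field.
    rewrite H3; field. }
  assert (Hm0 : 0 <= m) by apply Cmod_ge_0.
  rewrite Rabs_mult, (Rabs_pos_eq (IZR k * sqrt 3)) in E by nra.
  unfold Rdiv in E; rewrite Rabs_mult, (Rabs_pos_eq (/ 2)), <- abs_IZR in E by lra.
  assert (Hx2 : IZR x * IZR x = IZR (Z.abs x) * IZR (Z.abs x)) by (rewrite <- !mult_IZR; f_equal; lia).
  rewrite Hx2 in Hm; clear Hx2.
  assert (Hm1 : 4 * m = IZR k * sqrt 3 * (IZR (Z.abs x) - 4)) by lra.
  assert (EZ : (4 * (Z.abs x * Z.abs x + 3 * (y * y)) = 3 * (k * k * ((Z.abs x - 4) * (Z.abs x - 4))))%Z).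
  { apply eq_IZR. rewrite !mult_IZR, !plus_IZR, !mult_IZR, !minus_IZR.
    replace (4 * (IZR (Z.abs x) * IZR (Z.abs x) + 3 * (IZR y * IZR y))) with ((4 * m) * (4 * m)) by lra.
    rewrite Hm1.
    replace (IZR k * sqrt 3 * (IZR (Z.abs x) - 4) * (IZR k * sqrt 3 * (IZR (Z.abs x) - 4)))
      with (IZR k * IZR k * ((IZR (Z.abs x) - 4) * (IZR (Z.abs x) - 4)) * (sqrt 3 * sqrt 3)) by ring.
    rewrite H3; ring. }
  assert (Hx4 : (4 <= Z.abs x)%Z).
  { apply le_IZR. destruct (Rle_dec 4 (IZR (Z.abs x))) as [H|H]; [exact H|exfalso].
    assert (0 < IZR k * sqrt 3) by nra. nra. }
  assert (Ht : exists z, Z.abs x = (3 * z)%Z).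
  { pose proof (Z.div_mod (Z.abs x) 3 ltac:(lia)) as Hd.
    pose proof (Z.mod_pos_bound (Z.abs x) 3 ltac:(lia)) as Hr.
    exists (Z.abs x / 3)%Z.
    assert (Hc : (Z.abs x mod 3 = 0 \/ Z.abs x mod 3 = 1 \/ Z.abs x mod 3 = 2)%Z) by lia.
    clear - EZ Hd Hc. set (M := (k * k * _)%Z) in EZ; clearbody M.
    set (q := (Z.abs x / 3)%Z) in *; clearbody q.
    rewrite Hd in EZ.
    destruct Hc as [H|[H|H]]; rewrite H in Hd, EZ; lia. }
  destruct Ht as [z Hz]; exists z; rewrite Hz in *; clear - hk EZ Hx4.
  split; [reflexivity|]. split; [lia|]. nia.
Qed.

Lemma same_polygon_swap (a b c d : C) : same_polygon [b; a; d; c] [a; b; c; d].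
Proof. intros x y; unfold is_side, sides; simpl; intuition congruence. Qed.

(** Comparing squared coordinates covers at once rotation by [u], translations and reflections in
    lines parallel to the axes. *)
Lemma isometry_of_diff (f : C -> C) (u : C) (hu : Cmod u = 1)
  (hf : forall z w, let d := Cmult u (Cminus z w) in
     Re (Cminus (f z) (f w)) ^ 2 = Re d ^ 2 /\ Im (Cminus (f z) (f w)) ^ 2 = Im d ^ 2) :
  isometry f.
Proof.
  intros z w; destruct (hf z w) as [H1 H2].
  rewrite <- (Rmult_1_l (Cmod (Cminus z w))), <- hu, <- Cmod_mult.
  unfold Cmod; f_equal; unfold Re, Im in *; rewrite H1, H2; reflexivity.
Qed.

Lemma cross_mult (u p q : C) (hu : Cmod u = 1) :
  cross (Cmult u p) (Cmult u q) = cross p q.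
Proof.
  assert (H : fst u * fst u + snd u * snd u = 1).
  { replace 1 with (Cmod u * Cmod u) by (rewrite hu; ring).
    unfold Cmod; rewrite sqrt_sqrt by (simpl; nra); simpl; ring. }
  unfold cross, Re, Im; simpl.
  rewrite <- (Rmult_1_l (fst p * snd q - snd p * fst q)), <- H; ring.
Qed.

Lemma ELEP_normal_form (a b c d u : C) (k : Z) (h : ELEP [a; b; c; d])
  (hu : eisenstein u) (hu1 : Cmod u = 1) (hk : (1 <= k)%Z)
  (hp : Cmult u (Cminus b a) = (0, IZR k * sqrt 3)) :
  exists z y : Z, (2 <= z)%Z /\ (0 <= y)%Z /\ Z.Even (z - y) /\
    (12 * (z * z) + 4 * (y * y) = k * k * ((3 * z - 4) * (3 * z - 4)))%Z /\
    congruent [a; b; c; d]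
      [ (0, 0);
        (0, IZR k * sqrt 3);
        (- (3 * IZR z / 2), IZR k * sqrt 3 + IZR y * sqrt 3 / 2);
        (- (3 * IZR z / 2), IZR y * sqrt 3 / 2) ].
Proof.
  destruct h as ((a' & b' & c' & d' & E & H & Hn) & He & Hl).
  injection E as <- <- <- <-.
  assert (Hq : eisenstein (Cmult u (Cminus d a))).
  { apply eisenstein_mult; [exact hu|]. apply eisenstein_minus; apply Hl; simpl; tauto. }
  apply eisenstein_coords in Hq as (m & y & Hq).
  unfold equable in He.
  rewrite perimeter_parallelogram, area_parallelogram in He by exact H.
  rewrite <- (cross_mult u _ _ hu1), hp in He.
  rewrite <- (Rmult_1_l (Cmod (Cminus b a))), <- (Rmult_1_l (Cmod (Cminus d a))),
    <- hu1, <- !Cmod_mult, hp in He.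
  assert (Hq' : Cmult u (Cminus d a) = (IZR (2 * m - y) / 2, IZR y * sqrt 3 / 2)).
  { rewrite Hq, minus_IZR, mult_IZR; f_equal; field. }
  clear Hq; rename Hq' into Hq; rewrite Hq in He.
  pose proof sqrt3_pos as H3p.
  assert (Hk : 1 <= IZR k) by (apply IZR_le; exact hk).
  replace (Cmod (0, IZR k * sqrt 3)) with (IZR k * sqrt 3) in He.
  2:{ unfold Cmod; simpl.
      replace (0 * (0 * 1) + IZR k * sqrt 3 * (IZR k * sqrt 3 * 1))
        with (Rsqr (IZR k * sqrt 3)) by (unfold Rsqr; ring).
      rewrite sqrt_Rsqr; nra. }
  replace (Rabs (cross _ _)) with (Rabs (IZR k * sqrt 3 * (IZR (2 * m - y) / 2))) in He.
  2:{ unfold cross; simpl. rewrite <- (Rabs_Ropp (_ - _)); f_equal; ring. }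
  destruct (equable_equation k _ y hk He) as (z & Hz & Hz2 & HE).
  exists z, (Z.abs y).
  split; [exact Hz2|]. split; [lia|]. split.
  (* [2 * m - y] has the parity of [y], and its absolute value [3 * z] has the parity of [z]. *)
  { destruct (Z.abs_spec y) as [[_ ->]|[_ ->]], (Z.abs_spec (2 * m - y)) as [[_ A]|[_ A]];
      rewrite A in Hz.
    - exists (m - y - z)%Z; lia.
    - exists (- m - z)%Z; lia.
    - exists (m - z)%Z; lia.
    - exists (y - m - z)%Z; lia. }
  split; [rewrite <- HE; lia|].
  set (x := (2 * m - y)%Z) in *; clearbody x.
  (* The sign [s] reflects the parallelogram, if necessary, into the left half-plane. *)
  set (s := if Rle_dec 0 (IZR x) then -1 else 1).
  assert (Hs : s * s = 1 /\ s * (IZR x / 2) = - (3 * IZR z / 2)).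
  { assert (A : 3 * IZR z = IZR (Z.abs x)) by (rewrite Hz, mult_IZR; reflexivity).
    rewrite A, abs_IZR. unfold s; destruct (Rle_dec 0 (IZR x)).
    - rewrite Rabs_pos_eq by assumption; split; field.
    - rewrite Rabs_left by lra; split; field. }
  destruct Hs as [Hs Hsx].
  rewrite (parallelogram_vertex a b c d H).
  assert (Hc : Cmult u (Cminus (Cminus (Cplus b d) a) a) =
    (IZR x / 2, IZR k * sqrt 3 + IZR y * sqrt 3 / 2)).
  { replace (Cmult u _) with (Cplus (Cmult u (Cminus b a)) (Cmult u (Cminus d a)))
      by (apply injective_projections; simpl; ring).
    rewrite hp, Hq; apply injective_projections; simpl; ring. }
  assert (Ha : Cmult u (Cminus a a) = (0, 0)) by (apply injective_projections; simpl; ring).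
  destruct (Z_le_gt_dec 0 y) as [Hy|Hy].
  - rewrite Z.abs_eq by exact Hy.
    set (f := fun w => let v := Cmult u (Cminus w a) in (s * fst v, snd v) : C).
    exists f; split.
    + apply isometry_of_diff with u; [exact hu1|]. intros v w e; unfold e, f, Re, Im; simpl; split; [|ring].
      match goal with |- ?l = ?r => transitivity ((s * s) * r) end; [ring|rewrite Hs; ring].
    + cbn [map]. unfold f; rewrite Ha, hp, Hq, Hc; cbn [fst snd].
      rewrite Hsx, Rmult_0_r. intros v w; reflexivity.
  (* For negative [y], reflection in the horizontal line through the midpoint of the vertical side
     replaces [y] by [- y] and exchanges the endpoints of both vertical sides. *)
  - rewrite Z.abs_neq by lia.
    set (f := fun w => let v := Cmult u (Cminus w a) in (s * fst v, IZR k * sqrt 3 - snd v) : C).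
    exists f; split.
    + apply isometry_of_diff with u; [exact hu1|]. intros v w e; unfold e, f, Re, Im; simpl; split; [|ring].
      match goal with |- ?l = ?r => transitivity ((s * s) * r) end; [ring|rewrite Hs; ring].
    + cbn [map]. unfold f; rewrite Ha, hp, Hq, Hc; cbn [fst snd].
      rewrite Hsx, Rmult_0_r, opp_IZR.
      replace (IZR k * sqrt 3 - IZR k * sqrt 3) with 0 by ring.
      replace (IZR k * sqrt 3 - 0) with (IZR k * sqrt 3) by ring.
      replace (IZR k * sqrt 3 - IZR y * sqrt 3 / 2) with (IZR k * sqrt 3 + - IZR y * sqrt 3 / 2) by field.
      replace (IZR k * sqrt 3 - (IZR k * sqrt 3 + IZR y * sqrt 3 / 2)) with (- IZR y * sqrt 3 / 2) by field.
      apply same_polygon_swap.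
Qed.

(** Since 2 is inert and 3 ramified in [Z[ω]], every element of norm 12 or 48 is an associate of
    [k √3 i = k + 2kω]. The norm bounds [a] and [b] by 8 in absolute value, and the finitely many
    cases are checked against the six units [u + vω]. *)
Lemma eisenstein_unit_to_vertical (a b k : Z) (hk : k = 2%Z \/ k = 4%Z)
  (E : (a * a - a * b + b * b = 3 * (k * k))%Z) :
  exists u v : Z, (u * u - u * v + v * v = 1)%Z /\
    (u * a - v * b = k)%Z /\ (u * b + v * a - v * b = 2 * k)%Z.
Proof.
  assert (Hk : (k * k <= 16)%Z) by (destruct hk; subst k; lia).
  assert (Hb : (-8 <= b <= 8)%Z) by (pose proof (Z.square_nonneg (2 * a - b)); nia).
  assert (Ha : (-8 <= a <= 8)%Z) by (pose proof (Z.square_nonneg (2 * b - a)); nia).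
  clear Hk.
  assert (Hrange : forall n : Z, (-8 <= n <= 8)%Z ->
    In n [-8; -7; -6; -5; -4; -3; -2; -1; 0; 1; 2; 3; 4; 5; 6; 7; 8]%Z) by (intros n Hn; simpl; lia).
  apply Hrange in Hb, Ha; clear Hrange.
  destruct hk as [-> | ->];
    repeat (destruct Hb as [<-|Hb]; [repeat (destruct Ha as [<-|Ha]; [try (vm_compute in E; discriminate E)|]); try destruct Ha|]);
    try destruct Hb;
    first [ exists 1%Z, 0%Z; repeat split; lia | exists 0%Z, 1%Z; repeat split; lia
          | exists (-1)%Z, 0%Z; repeat split; lia | exists 0%Z, (-1)%Z; repeat split; lia
          | exists 1%Z, 1%Z; repeat split; lia | exists (-1)%Z, (-1)%Z; repeat split; lia ].
Qed.

Lemma Cmod_vertical (t : R) (ht : 0 <= t) : Cmod (0, t) = t.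
Proof.
  unfold Cmod; simpl. replace (0 * (0 * 1) + t * (t * 1)) with (Rsqr t) by (unfold Rsqr; ring).
  apply sqrt_Rsqr; exact ht.
Qed.

Lemma Cmod_eisenstein_sq (a b : Z) :
  Cmod (IZR a - IZR b / 2, IZR b * sqrt 3 / 2) * Cmod (IZR a - IZR b / 2, IZR b * sqrt 3 / 2) =
  IZR (a * a - a * b + b * b).
Proof.
  pose proof sqrt3_sq as H3.
  unfold Cmod; rewrite sqrt_sqrt by (apply Rplus_le_le_0_compat; apply pow2_ge_0); simpl.
  replace (IZR b * sqrt 3 / 2 * (IZR b * sqrt 3 / 2 * 1))
    with (IZR b * IZR b * (sqrt 3 * sqrt 3) / 4) by field.
  rewrite H3, plus_IZR, minus_IZR, !mult_IZR; field.
Qed.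

Lemma ELEP_normal_form_of_side (P : polygon) (k : Z) (hk : k = 2%Z \/ k = 4%Z)
  (h : ELEP P) (hs : has_side_of_length P (IZR k * sqrt 3)) :
  exists z y : Z, (2 <= z)%Z /\ (0 <= y)%Z /\
    (12 * (z * z) + 4 * (y * y) = k * k * ((3 * z - 4) * (3 * z - 4)))%Z /\
    congruent P
      [ (0, 0);
        (0, IZR k * sqrt 3);
        (- (3 * IZR z / 2), IZR k * sqrt 3 + IZR y * sqrt 3 / 2);
        (- (3 * IZR z / 2), IZR y * sqrt 3 / 2) ].
Proof.
  destruct hs as (s & Hs & Hl).
  destruct (ELEP_start_at_side P s h Hs) as (a & b & c & d & HP & HE & ->).
  unfold side_length in Hl; cbn [fst snd] in Hl.
  assert (Hp : eisenstein (Cminus b a))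
    by (apply eisenstein_minus; apply (proj2 (proj2 HE)); simpl; tauto).
  apply eisenstein_coords in Hp as (m & n & Hp).
  assert (Hmn : (m * m - m * n + n * n = 3 * (k * k))%Z).
  { apply eq_IZR; rewrite <- Cmod_eisenstein_sq, <- Hp, Hl, !mult_IZR.
    transitivity (IZR k * IZR k * (sqrt 3 * sqrt 3)); [ring|rewrite sqrt3_sq; ring]. }
  destruct (eisenstein_unit_to_vertical m n k hk Hmn) as (u & v & Huv & H1 & H2).
  set (w := (IZR u - IZR v / 2, IZR v * sqrt 3 / 2) : C).
  assert (Hw : Cmult w (Cminus b a) = (0, IZR k * sqrt 3)).
  { apply (f_equal IZR) in H1, H2.
    rewrite minus_IZR, !mult_IZR in H1; rewrite minus_IZR, plus_IZR, !mult_IZR in H2.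
    rewrite Hp; unfold w, Cmult; cbn [fst snd]; f_equal.
    (* The last summand is zero; it absorbs the [sqrt 3 * sqrt 3] coming from the product of the
       imaginary parts. *)
    - transitivity ((IZR u * IZR m - IZR v * IZR n) - (IZR u * IZR n + IZR v * IZR m - IZR v * IZR n) / 2
        + IZR v * IZR n * (3 - sqrt 3 * sqrt 3) / 4); [field|].
      rewrite H1, H2, sqrt3_sq; field.
    - transitivity ((IZR u * IZR n + IZR v * IZR m - IZR v * IZR n) * sqrt 3 / 2); [field|].
      rewrite H2; field. }
  assert (Hw1 : Cmod w = 1).
  { pose proof (Cmod_eisenstein_sq u v) as Hsq; fold w in Hsq; rewrite Huv in Hsq.
    pose proof (Cmod_ge_0 w); nra. }
  destruct (ELEP_normal_form a b c d w k HE) as (z & y & Hz & Hy & _ & Heq & Hc);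
    [apply eisenstein_coords; exists u, v; reflexivity | exact Hw1 | lia | exact Hw |].
  exists z, y; do 3 (split; [assumption|]).
  apply congruent_trans with [a; b; c; d]; [apply same_polygon_congruent; exact HP | exact Hc].
Qed.

Lemma normal_form_even (k t y : Z) :
  [ (0, 0);
    (0, IZR k * sqrt 3);
    (- (3 * IZR (2 * t) / 2), IZR k * sqrt 3 + IZR (2 * y) * sqrt 3 / 2);
    (- (3 * IZR (2 * t) / 2), IZR (2 * y) * sqrt 3 / 2) ] =
  vertical_parallelogram k (3 * t) y.
Proof.
  unfold vertical_parallelogram; rewrite plus_IZR, !mult_IZR.
  repeat first [reflexivity | apply f_equal2 | field].
Qed.

Lemma even_of_even_sq (n : Z) (h : Z.Even (n * n)) : exists m, n = (2 * m)%Z.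
Proof.
  destruct (Z.Even_or_Odd n) as [H|H]; [exact H|].
  exact (even_of_mul_odd n n H h).
Qed.

(** * Classification by side length *)

(** For [k = 2] the equation reads [y² = 6 z² - 24 z + 16]. Parity gives [y = 4 m] and [z = 2 t],
    and completing the square leaves [3 (t - 1)² = 2 m² + 1]. *)
Lemma ELEP_side_2 (P : polygon) (h : ELEP P) (hs : has_side_of_length P (2 * sqrt 3)) :
  exists n : nat, (1 <= n)%nat /\ congruent P (Q_ n).
Proof.
  destruct (ELEP_normal_form_of_side P 2 (or_introl eq_refl) h hs) as (z & y & Hz & Hy & E & Hc).
  destruct (even_of_even_sq y) as [y1 ->]; [exists (3 * (z * z) - 12 * z + 8)%Z; lia|].
  destruct (even_of_even_sq z) as [t ->].
  { destruct (even_of_mul_odd (z * z) 3) as [e He]; [exists 1%Z; lia| |exists e; lia].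
    exists (y1 * y1 + 6 * z - 4)%Z; lia. }
  destruct (even_of_even_sq y1) as [m ->]; [exists (3 * (t * t) - 6 * t + 2)%Z; lia|].
  destruct (um_complete (t - 1) m) as (n & Hn & En).
  - assert (t <> 1)%Z by (intros ->; nia). lia.
  - assert (m <> 0)%Z by (intros ->; clear - E; lia). lia.
  - lia.
  - exists n; split; [exact Hn|]. unfold Q_; rewrite En; cbn [fst snd].
    rewrite normal_form_even in Hc.
    replace (3 + 3 * (t - 1))%Z with (3 * t)%Z by lia. exact Hc.
Qed.

(** [Q_ 1] has sides [2√3] and [4√3]. Multiplication by [ω] followed by conjugation makes the
    shorter side vertical instead of the longer one. *)
Lemma congruent_4_3_1_Q1 : congruent (vertical_parallelogram 4 3 1) (Q_ 1).
Proof.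
  set (u := (- (1 / 2), sqrt 3 / 2) : C).
  assert (Hu : Cmod u = 1).
  { unfold Cmod, u; cbn [fst snd].
    replace ((- (1 / 2)) ^ 2 + (sqrt 3 / 2) ^ 2) with (1 / 4 + (sqrt 3 * sqrt 3) / 4) by field.
    rewrite sqrt3_sq. replace (1 / 4 + 3 / 4) with 1 by field. apply sqrt_1. }
  exists (fun z => Cconj (Cmult u z)); split.
  - apply isometry_of_diff with u; [exact Hu|]. intros v w d; unfold d, Re, Im; simpl; split; ring.
  - unfold Q_, vertical_parallelogram.
    apply same_polygon_trans with
      [(0, 0); (-6, 2 * sqrt 3); (-6, 4 * sqrt 3); (0, 2 * sqrt 3)].
    2:{ unfold um; cbn [fst snd]. apply same_polygon_reverse. }
    match goal with |- same_polygon ?a ?b => replace a with b; [intros x y; reflexivity|] end.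
    pose proof sqrt3_sq as H3. cbn [map].
    unfold Cconj, Cmult, u; cbn [fst snd Z.add Pos.add Pos.succ].
    repeat first [reflexivity | apply f_equal2]; nra.
Qed.

Lemma ELEP_side_4 (P : polygon) (h : ELEP P) (hs : has_side_of_length P (4 * sqrt 3)) :
  congruent P (Q_ 1) \/
  exists n : nat, (1 <= n)%nat /\ (congruent P (R_ n) \/ congruent P (R'_ n)).
Proof.
  destruct (ELEP_normal_form_of_side P 4 (or_intror eq_refl) h hs) as (z & y & Hz & Hy & E & Hc).
  destruct (wy_complete z y Hz Hy ltac:(lia)) as [[-> ->]|(n & i & Hn & Hi & -> & ->)].
  (* This is the solution [w = 0], [y = 1] of the Pell equation, which precedes the positive
     ones. *)
  - left. apply congruent_trans with (2 := congruent_4_3_1_Q1).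
    change (vertical_parallelogram 4 3 1) with (vertical_parallelogram 4 (3 * 1) 1).
    rewrite <- normal_form_even; exact Hc.
  - right. exists n; split; [exact Hn|].
    replace (4 * fst (wy i n) + 2)%Z with (2 * (2 * fst (wy i n) + 1))%Z in Hc by ring.
    rewrite normal_form_even in Hc.
    replace (3 * (2 * fst (wy i n) + 1))%Z with (6 * fst (wy i n) + 3)%Z in Hc by ring.
    destruct Hi as [->| ->]; [left|right]; exact Hc.
Qed.

(** * Membership of the families, and vertical sides *)

(** The slanted side has length [r √3], so [E] is the equality of perimeter and area divided by
    [√3]. *)
Lemma vertical_parallelogram_ELEP (k x y r : Z) (hk : (0 < k)%Z) (hx : (0 < x)%Z) (hr : (0 <= r)%Z)
  (Er : (x * x + 3 * (y * y) = 3 * (r * r))%Z) (E : (2 * (k + r) = k * x)%Z) :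
  ELEP (vertical_parallelogram k x y) /\
  has_side_of_length (vertical_parallelogram k x y) (IZR k * sqrt 3).
Proof.
  pose proof sqrt3_sq as H3. pose proof sqrt3_pos as H3p.
  assert (Hk : 0 < IZR k) by (apply IZR_lt; exact hk).
  assert (Hx : 0 < IZR x) by (apply IZR_lt; exact hx).
  assert (Hr : 0 <= IZR r) by (apply IZR_le; exact hr).
  assert (Hks : 0 < IZR k * sqrt 3) by nra.
  set (p := (0, IZR k * sqrt 3) : C). set (q := (- IZR x, IZR y * sqrt 3) : C).
  set (o := (0, 0) : C). set (c := (- IZR x, IZR (k + y) * sqrt 3) : C).
  change (vertical_parallelogram k x y) with [o; p; c; q].
  assert (Hp : Cminus p o = p) by (apply injective_projections; simpl; ring).
  assert (Hq : Cminus q o = q) by (apply injective_projections; simpl; ring).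
  assert (Hpar : Cminus p o = Cminus c q)
    by (apply injective_projections; simpl; rewrite ?plus_IZR; ring).
  assert (Hcr : cross p q = IZR k * sqrt 3 * IZR x) by (unfold cross; simpl; ring).
  assert (Hlp : Cmod p = IZR k * sqrt 3) by (apply Cmod_vertical; lra).
  assert (Hlq : Cmod q = IZR r * sqrt 3).
  { unfold Cmod, q; cbn [fst snd].
    apply (f_equal IZR) in Er; rewrite !plus_IZR, !mult_IZR in Er.
    replace ((- IZR x) ^ 2 + (IZR y * sqrt 3) ^ 2) with (Rsqr (IZR r * sqrt 3)).
    - apply sqrt_Rsqr; nra.
    - unfold Rsqr.
      transitivity (IZR r * IZR r * (sqrt 3 * sqrt 3)); [ring|].
      transitivity (IZR x * IZR x + IZR y * IZR y * (sqrt 3 * sqrt 3)); [rewrite H3; lra|ring]. }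
  split; [split; [|split]|].
  - exists o, p, c, q; split; [reflexivity|]; split; [exact Hpar|].
    rewrite cross_conj, Hp, Hq, Hcr; nra.
  - unfold equable. rewrite perimeter_parallelogram, area_parallelogram by exact Hpar.
    rewrite Hp, Hq, Hcr, Hlp, Hlq, Rabs_pos_eq by nra.
    apply (f_equal IZR) in E; rewrite !mult_IZR, plus_IZR in E.
    transitivity (2 * (IZR k + IZR r) * sqrt 3); [ring|rewrite E; ring].
  - assert (Hv : forall s t : Z, eisenstein (- IZR s, IZR t * sqrt 3)).
    { intros s t; apply eisenstein_coords; exists (t - s)%Z, (2 * t)%Z.
      rewrite minus_IZR, mult_IZR; apply f_equal2; field. }
    intros z [<-|[<-|[<-|[<-|[]]]]].
    + replace o with (- IZR 0, IZR 0 * sqrt 3); [apply Hv|unfold o; apply f_equal2; ring].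
    + replace p with (- IZR 0, IZR k * sqrt 3); [apply Hv|unfold p; apply f_equal2; ring].
    + apply Hv.
    + apply Hv.
  - exists (o, p); split; [left; reflexivity|].
    unfold side_length; cbn [fst snd]; rewrite Hp; exact Hlp.
Qed.

Lemma Q_ELEP (n : nat) (hn : (1 <= n)%nat) :
  ELEP (Q_ n) /\ has_side_of_length (Q_ n) (2 * sqrt 3).
Proof.
  destruct (um_pell n hn) as (E & Hu & Hm).
  (* For [k = 2] equability forces [r = x - 2]. *)
  unfold Q_; apply vertical_parallelogram_ELEP with (r := (3 * fst (um n) + 1)%Z); lia.
Qed.

Lemma R_family_ELEP (i : Z * Z) (n : nat) (hn : (1 <= n)%nat)
  (hi : (132 * (fst i * fst i) + 36 * fst i + 1 = snd i * snd i /\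
         0 < fst i /\ 0 < snd i)%Z) :
  ELEP (R_family i n) /\ has_side_of_length (R_family i n) (4 * sqrt 3).
Proof.
  destruct (wy_pell i n hn hi) as (E & Hw & Hy).
  (* For [k = 4] equability forces [r = 2 x - 4]. *)
  unfold R_family; apply vertical_parallelogram_ELEP with (r := (12 * fst (wy i n) + 2)%Z); lia.
Qed.

(** A purely imaginary lattice vector is [m √3 i] with [m] an integer. The unit [Z.sgn m] makes it
    point upwards, and the normal form with [k = Z.abs m] leaves only 2 and 4. *)
Lemma ELEP_vertical_side (P : polygon) (h : ELEP P) (hv : has_vertical_side P) :
  has_side_of_length P (2 * sqrt 3) \/ has_side_of_length P (4 * sqrt 3).
Proof.
  destruct hv as (s & Hs & Hne & Hre).
  destruct (ELEP_start_at_side P s h Hs) as (a & b & c & d & HP & HE & ->).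
  cbn [fst snd] in Hne, Hre.
  assert (Hp : eisenstein (Cminus b a))
    by (apply eisenstein_minus; apply (proj2 (proj2 HE)); simpl; tauto).
  apply eisenstein_coords in Hp as (m & n & Hp).
  assert (Hn : n = (2 * m)%Z).
  { apply eq_IZR; rewrite mult_IZR. apply (f_equal Re) in Hp; simpl in Hp; unfold Re in Hre; lra. }
  assert (Hp' : Cminus b a = (0, IZR m * sqrt 3)).
  { rewrite Hp, Hn, mult_IZR; apply f_equal2; field. }
  assert (Hm : m <> 0%Z).
  { intros ->. apply Hne. destruct a, b; unfold Cminus, Cplus, Copp in Hp'; simpl in Hp'.
    injection Hp' as A B; apply f_equal2; lra. }
  assert (Hu : exists e : Z, (e * e = 1 /\ e * m = Z.abs m)%Z).
  { exists (Z.sgn m); split; [lia|]. lia. }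
  destruct Hu as (e & He & Hem).
  set (u := (IZR e - IZR 0 / 2, IZR 0 * sqrt 3 / 2) : C).
  assert (Hup : Cmult u (Cminus b a) =
    (0, IZR (Z.abs m) * sqrt 3)).
  { rewrite Hp', <- Hem, mult_IZR; unfold u, Cmult; cbn [fst snd]; apply f_equal2; field. }
  assert (Hu1 : Cmod u = 1).
  { pose proof (Cmod_eisenstein_sq e 0) as Hsq; fold u in Hsq.
    replace (e * e - e * 0 + 0 * 0)%Z with 1%Z in Hsq by lia.
    pose proof (Cmod_ge_0 u); nra. }
  destruct (ELEP_normal_form a b c d u (Z.abs m) HE)
    as (z & y & Hz & _ & Hzy & Heq & _);
    [apply eisenstein_coords; exists e, 0%Z; reflexivity | exact Hu1 | lia | exact Hup |].
  assert (Hlen : side_length (a, b) = IZR (Z.abs m) * sqrt 3).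
  { unfold side_length; cbn [fst snd].
    rewrite <- (Rmult_1_l (Cmod _)), <- Hu1, <- Cmod_mult, Hup.
    apply Cmod_vertical. pose proof sqrt3_pos.
    assert (0 <= IZR (Z.abs m)) by (apply IZR_le; lia). nra. }
  destruct (vertical_side_2_or_4 (Z.abs m) z y ltac:(lia) Hz Hzy Heq) as [A|A];
    rewrite A in Hlen; [left|right]; exists (a, b); auto.
Qed.

Theorem theorem7 :
  (* side length 2 sqrt 3 *)
  (forall P : polygon, ELEP P -> has_side_of_length P (2 * sqrt 3) ->
     exists n : nat, (1 <= n)%nat /\ congruent P (Q_ n)) /\
  (forall n : nat, (1 <= n)%nat ->
     ELEP (Q_ n) /\ has_side_of_length (Q_ n) (2 * sqrt 3)) /\
  (* side length 4 sqrt 3; [Q_ 1] has sides of both lengths *)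
  (forall P : polygon, ELEP P -> has_side_of_length P (4 * sqrt 3) ->
     congruent P (Q_ 1) \/
     exists n : nat, (1 <= n)%nat /\ (congruent P (R_ n) \/ congruent P (R'_ n))) /\
  (forall n : nat, (1 <= n)%nat ->
     (ELEP (R_ n) /\ has_side_of_length (R_ n) (4 * sqrt 3)) /\
     (ELEP (R'_ n) /\ has_side_of_length (R'_ n) (4 * sqrt 3))) /\
  (* vertical sides *)
  (forall P : polygon, ELEP P -> has_vertical_side P ->
     has_side_of_length P (2 * sqrt 3) \/ has_side_of_length P (4 * sqrt 3)).
Proof.
  split; [exact ELEP_side_2|]. split; [exact Q_ELEP|]. split; [exact ELEP_side_4|].
  split; [|exact ELEP_vertical_side].
  intros n hn; split; apply R_family_ELEP; cbn [fst snd]; lia.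
Qed.
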